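(* Every monotonically normal and weakly linearly Lindelöf space is Lindelöf.
   Context: All spaces are topological spaces assumed to be $T_1$. For a space $X$, $\tau(X)$ is its topology, $\tau^*(X)=\tau(X)\setminus\{\emptyset\}$, and $\tau(x,X)=\{U\in\tau(X): x\in U\}$ for $x\in X$. A space is Lindelöf if every open cover has a countable subcover (no separation axiom is included in this definition). A space $X$ is weakly linearly Lindelöf if for any family $\mathcal{U}\subset\tau^*(X)$ such that $\kappa=|\mathcal{U}|$ is an uncountable regular cardinal, there is a point $x\in X$ such that every $V\in\tau(x,X)$ intersects $\kappa$-many elements of $\mathcal{U}$. A space $X$ is monotonically normal if it admits an operator $O$ that assigns to any point $x\in X$ and any $U\in\tau(x,X)$ a set $O(x,U)\in\tau(x,X)$ such that $O(x,U)\subset U$ and, for any points $x,y\in X$ and sets $U,V\in\tau(X)$ with $x\in U$ and $y\in V$, it follows from $O(x,U)\cap O(y,V)\neq\emptyset$ that $x\in V$ or $y\in U$. *)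

(* Defs.v *)
From mathcomp Require Import all_boot all_order all_classical topology.

Set Implicit Arguments.
Unset Strict Implicit.
Unset Printing Implicit Defensive.

Local Open Scope classical_set_scope.
Local Open Scope card_scope.

Definition card_lt T U (A : set T) (B : set U) : Prop :=
  A #<= B /\ ~ (B #<= A).

(* The cardinal |A| is regular: it is infinite, and A is not the union of
   fewer than |A| sets, each of cardinality less than |A|. *)
Definition regular_card T (A : set T) : Prop :=
  infinite_set A /\
  forall C : set (set T), card_lt C A -> (forall B, C B -> card_lt B A) ->
    \bigcup_(B in C) B <> A.

Definition lindelof (X : topologicalType) : Prop :=
  forall C : set (set X), (forall U, C U -> open U) ->
    \bigcup_(U in C) U = [set: X] ->
    exists D : set (set X),
      [/\ D `<=` C, countable D & \bigcup_(U in D) U = [set: X]].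

Definition weakly_linearly_lindelof (X : topologicalType) : Prop :=
  forall F : set (set X), (forall U, F U -> open U /\ U !=set0) ->
    ~ countable F -> regular_card F ->
    exists x : X, forall V : set X, open_nbhs x V ->
      [set U | F U /\ V `&` U !=set0] #= F.

(* Only the values O x U with U an open neighborhood of x matter. *)
Definition monotonically_normal (X : topologicalType) : Prop :=
  exists O : X -> set X -> set X,
    (forall x U, open_nbhs x U -> open_nbhs x (O x U) /\ O x U `<=` U) /\
    (forall x y U V, open_nbhs x U -> open_nbhs y V ->
       O x U `&` O y V !=set0 -> V x \/ U y).

(* Main.v *)
Require Import Defs.
From mathcomp Require Import all_boot all_order all_classical topology.
From mathcomp Require Import wochoice.

(** Why the theorem holds.  Suppose that [X] is not Lindelof, and among all the
families of open sets that cover some closed set [K] without a countable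
subfamily covering [K] choose one, [C], of least cardinality kappa; kappa is
uncountable.

If kappa is regular, well-order [C] with initial segments of size less than
kappa.  For each [U] in [C] that is the least member containing some point of
[K], fix such a point [x U].  By minimality there are kappa of these points,
and they are right-separated: [U] is a neighborhood of [x U] that misses the
later points.  Two facts about monotone normality now clash.  First, kappa of
the points form a discrete subspace ([right_separated_discrete]).  Second, a
discrete subspace expands to pairwise disjoint open sets, so that weak linear
Lindelofness yields a point [y] all of whose neighborhoods contain kappa of
these [x U] ([discrete_complete_accumulation]).  Then [y] lies in the closed
set [K], hence in some member [U] of [C]; but [U] contains only points indexed
by an initial segment.

If kappa is singular, [C] is the union of fewer than kappa subfamilies, each of
size less than kappa.  By minimality countably many of the unions of these
subfamilies cover [K].  Weak linear Lindelofness concerns regular cardinals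
only; what helps in the singular case is that a monotonically normal space is
countably paracompact, in the following form: an increasing countable open
cover [W n] admits closed sets [F n] inside [W n] which still cover the space
([monotonically_normal_exhaustion]).  Each piece of [K] in [F n] is a closed
set covered by finitely many small subfamilies, so minimality covers it by
countably many members of [C]. *)

Set Implicit Arguments.
Unset Strict Implicit.
Unset Printing Implicit Defensive.

Local Open Scope classical_set_scope.
Local Open Scope card_scope.

(** * Cardinals *)

Lemma card_le_injection T U (A : set T) (B : set U) : A !=set0 -> A #<= B ->
  exists f : T -> U, (forall a, A a -> B (f a)) /\
    (forall a b, A a -> A b -> f a = f b -> a = b).
Proof.
elim/Ppointed: U => U in B *.
  by rewrite emptyE => -[a Aa] /eqP A0; move: Aa; rewrite A0.
move=> _ /pcard_leP[f]; exists f; split; first by move=> a Aa; exact: funS.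
by move=> a b Aa Ab; apply: inj; exact: mem_set.
Qed.

Lemma injection_card_le T U (A : set T) (B : set U) (f : T -> U) :
  (forall a, A a -> B (f a)) ->
  (forall a b, A a -> A b -> f a = f b -> a = b) -> A #<= B.
Proof.
move=> fAB fI; have /card_eqPle[_ /card_le_trans] : f @` A #= A.
  by apply: inj_card_eq => a b /set_mem Aa /set_mem Ab; exact: fI.
by apply; apply: subset_card_le => _ [a Aa <-]; exact: fAB.
Qed.

(** Cardinals are well-founded.  Take, by Zorn's lemma, a maximal set [G] of
choice functions on [S] whose evaluation at each member of [S] is injective.
If no member of [S] were exhausted by the values of [G], a choice function with
only new values could be added; an exhausted member [A] then has at most as
many elements as [G], and [G] injects into every member. *)
Lemma exists_minimal_card T (S : set (set T)) : S !=set0 ->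
  exists2 A, S A & forall B, S B -> A #<= B.
Proof.
move=> [A0 SA0].
pose P (G : set (set T -> T)) :=
  (forall f A, G f -> S A -> A (f A)) /\
  (forall f g A, G f -> G g -> S A -> f A = g A -> f = g).
have [|G [[GS Ginj] Gmax]] := @Zorn_bigcup _ P.
  move=> F FP Ftot; split=> [f A [G FG Gf]|f g A [G FG Gf] [H FH Hg]].
    exact: (FP _ FG).1.
  have [GH|HG] := Ftot _ _ FG FH.
    by apply: (FP _ FH).2 => //; exact: GH.
  by apply: (FP _ FG).2 => //; exact: HG.
have [[A SA AG]|noA] := pselect (exists2 A, S A & A `<=` [set f A | f in G]).
  exists A => // B SB; apply: card_le_trans (_ : G #<= B).
    exact: card_le_trans (subset_card_le AG) (card_image_le _ _).
  apply: (@injection_card_le _ _ _ _ (fun f => f B)) => [f Gf|f g Gf Gg].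
    exact: (GS f B Gf SB).
  by move=> fgB; exact: (Ginj f g B Gf Gg SB fgB).
(* Outside [S] the value of a choice function is irrelevant. *)
have fresh A : exists a, S A -> A a /\ forall f, G f -> f A <> a.
  have [SA|nSA] := pselect (S A); last first.
    have [a Aa] : A0 !=set0.
      apply/set0P/eqP => A00; apply: noA; exists A0 => // x.
      by rewrite A00.
    by exists a.
  have /existsNP[a /not_implyP[Aa Ga]] : ~ A `<=` [set f A | f in G].
    by move=> AG; apply: noA; exists A.
  by exists a => _; split=> // f Gf fAa; apply: Ga; exists f.
have [h hP] := choice fresh.
have hG : ~ G h by move=> Gh; have [_ /(_ h Gh)] := hP A0 SA0.
case: (Gmax (G `|` [set h])).
  by split=> [f|GhG]; [left | apply: hG; apply: GhG; right].
split=> [f A [Gf|->] SA|f g A [Gf|->] [Gg|->] SA //].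
- exact: (GS f A Gf SA).
- by have [] := hP A SA.
- exact: (Ginj f g A).
- by have [_ /(_ f Gf)] := hP A SA.
- by have [_ /(_ g Gg) ne] := hP A SA => /esym.
Qed.

(** Every set carries a well-order in the type of its initial ordinal.  If some
initial segment of a well-ordered [A] is as large as [A], the order is pulled
back along an injection of [A] into the shortest such segment. *)
Lemma exists_initial_order T (A : set T) :
  exists le : T -> T -> Prop,
    [/\ forall B, B `<=` A -> B !=set0 ->
          exists2 m, B m & forall b, B b -> le m b,
        forall a b, A a -> A b -> le a b -> le b a -> a = b &
        forall a, A a -> ~ (A #<= [set b | A b /\ ~ le a b])].
Proof.
elim/Peq: T A => T A.
have [R Rwo] := well_ordering_principle T.
have Rmin (B : set T) : B !=set0 -> exists2 m, B m & forall b, B b -> R m b.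
  move=> [b Bb]; have [|m [[mB mle] _]] := Rwo [pred x | `[<B x>]].
    by exists b; exact/asboolP.
  by exists m => [|c Bc]; [exact/asboolP | apply: mle; exact/asboolP].
have Ranti (a b : T) : R a b -> R b a -> a = b.
  move=> ab ba; have [|m [_ mu]] := Rwo (pred2 a b).
    by exists a; rewrite inE eqxx.
  have Rxx (x : T) : R x x.
    by have [|_ -> xx] := Rmin [set x]; [exists x | exact: xx].
  have <- : m = a.
    by apply: mu; split=> [|c]; rewrite !inE ?eqxx// => /orP[]/eqP->.
  by apply: mu; split=> [|c]; rewrite !inE ?eqxx ?orbT// => /orP[]/eqP->.
pose bad := [set a | A a /\ A #<= [set b | A b /\ ~ R a b]].
have [bad0|nbad0] := pselect (bad !=set0); last first.
  exists R; split=> [B _|//|a Aa Ale]; first exact: Rmin.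
    by move=> *; exact: Ranti.
  by apply: nbad0; exists a.
have [a [Aa Ale] amin] := Rmin _ bad0.
have [f [fA fI]] := card_le_injection (ex_intro _ a Aa) Ale.
exists (fun x y => R (f x) (f y)); split.
- move=> B BA [b Bb]; have [|_ [m Bm <-] mle] := Rmin (f @` B).
    by exists (f b), b.
  by exists m => // c Bc; apply: mle; exists c.
- by move=> x y Ax Ay fxy fyx; apply: fI => //; exact: Ranti.
- move=> c Ac cle; have [Afc nac] := fA _ Ac; apply: nac; apply: amin.
  split=> //; apply: card_le_trans cle _.
  apply: (@injection_card_le _ _ _ _ f) => [b [Ab nb]|b d [Ab _] [Ad _]].
    by split=> //; have [] := fA _ Ab.
  exact: fI.
Qed.

Lemma regular_card_eq T U (A : set T) (B : set U) :
  A #= B -> regular_card A -> regular_card B.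
Proof.
rewrite card_eq_sym => /card_eqPle[BA AB] [Ainf Areg].
have Binf : infinite_set B by apply: contra_not Ainf; exact: card_le_finite.
split=> // C [CB BC] Csmall CE.
have [f [fA fI]] := card_le_injection (infinite_setN0 Ainf) AB.
apply: (Areg [set A `&` f @^-1` S | S in C]).
- split.
    exact: card_le_trans (card_image_le _ _) (card_le_trans CB BA).
  move=> AleC; apply: BC; apply: card_le_trans BA _.
  exact: card_le_trans AleC (card_image_le _ _).
- move=> _ [S CS <-]; split; first by apply: subset_card_le => x [].
  move=> Ale; apply: (Csmall S CS).2; apply: card_le_trans BA _.
  apply: card_le_trans Ale _.
  apply: (@injection_card_le _ _ _ _ f) => [a []//|a b [Aa _] [Ab _]].
  exact: fI.
- apply/seteqP; split=> [x [_ [i Ii <-]] []//|x Ax].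
  have : B (f x) by exact: fA.
  by rewrite -CE => -[S CS Sfx]; exists (A `&` f @^-1` S) => //; exists S.
Qed.

(** The form in which regularity is used below: the pieces may be arbitrary sets
of another type, so that no families of subsets of [A] have to be formed. *)
Lemma regular_pigeonhole T J U (A : set T) (I : set J) (B : J -> set U) :
  regular_card A -> card_lt I A -> A #<= \bigcup_(i in I) B i ->
  exists2 i, I i & A #<= B i.
Proof.
move=> Areg [IA AI] /card_subP[C CA CB]; apply: contrapT => noi.
have /card_eqPle[CleA AleC] := CA.
have [_ Creg] : regular_card C.
  by apply: regular_card_eq Areg; rewrite card_eq_sym.
apply: (Creg [set C `&` B i | i in I]).
- split.
    exact: card_le_trans (card_image_le _ _) (card_le_trans IA AleC).
  move=> CleD; apply: AI; apply: card_le_trans AleC _.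
  apply: card_le_trans CleD _; exact: card_image_le.
- move=> _ [i Ii <-]; split; first by apply: subset_card_le => x [].
  move=> Cle; apply: noi; exists i => //; apply: card_le_trans AleC _.
  by apply: card_le_trans Cle _; apply: subset_card_le => x [].
- apply/seteqP; split=> [x [_ [i Ii <-]] []//|x Cx].
  by have [i Ii Bx] := CB _ Cx; exists (C `&` B i) => //; exists i.
Qed.

Lemma regular_card_le_setU T U (A : set T) (B C : set U) : regular_card A ->
  A #<= B `|` C -> A #<= B \/ A #<= C.
Proof.
move=> Areg ABC; have [||[] _ ?] := @regular_pigeonhole _ _ _ A [set: bool]
  (fun b : bool => if b then B else C) Areg; [| |by left|by right].
- have Ainf : infinite_set A by case: Areg.
  have fb : finite_set [set: bool] by exact: finite_finset.
  split; last by move=> /card_le_finite /(_ fb).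
  apply: card_le_trans (_ : [set: nat] #<= A); first exact: countableP.
  by apply/infiniteP.
- apply: card_le_trans ABC _; apply: subset_card_le.
  by move=> x [Bx|Cx]; [exists true | exists false].
Qed.

(** * Right-separated families in monotonically normal spaces *)

(** Replacing [O x U] by the union of the [O x V] over all smaller neighborhoods
[V] makes the operator monotone in its second argument, so that iterates of it
started from nested neighborhoods stay nested. *)
Lemma monotone_operator (X : topologicalType) : monotonically_normal X ->
  exists O : X -> set X -> set X,
    [/\ forall x U, open_nbhs x U -> open_nbhs x (O x U) /\ O x U `<=` U,
        forall x y U V, open_nbhs x U -> open_nbhs y V ->
          O x U `&` O y V !=set0 -> V x \/ U y &
        forall x U V, U `<=` V -> O x U `<=` O x V].
Proof.
move=> [O [Onb Osep]].
exists (fun x U => \bigcup_(V in [set V | open_nbhs x V /\ V `<=` U]) O x V).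
split=> [x U Ux|x y U V _ _|x U V UV]; last first.
- move=> z [W [Wx WU] Oz]; exists W => //; split=> //.
  exact: subset_trans UV.
- move=> [z [[U' [U'x U'U] zU'] [V' [V'y V'V] zV']]].
  have [|?|?] := Osep _ _ _ _ U'x V'y; first by exists z.
    by left; exact: V'V.
  by right; exact: U'U.
split; last first.
  by move=> z [V [Vx VU] Oz]; apply: VU; have [_] := Onb _ _ Vx; exact.
split; last by exists U; [split | have [[]] := Onb _ _ Ux].
by apply: bigcup_open => V [Vx _]; have [[]] := Onb _ _ Vx.
Qed.

Section MonotoneNormality.
Variables (X : topologicalType) (O : X -> set X -> set X).
Hypothesis T1 : accessible_space X.
Hypothesis O_nbhs : forall x U, open_nbhs x U ->
  open_nbhs x (O x U) /\ O x U `<=` U.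
Hypothesis O_sep : forall x y U V, open_nbhs x U -> open_nbhs y V ->
  O x U `&` O y V !=set0 -> V x \/ U y.
Hypothesis O_mono : forall x U V, U `<=` V -> O x U `<=` O x V.

(** The points [x a], [a] in [A], are distinct and form a discrete subspace. *)
Definition discrete_family T (x : T -> X) (A : set T) :=
  exists N : T -> set X, forall a, A a ->
    open_nbhs (x a) (N a) /\ forall b, A b -> N a (x b) -> a = b.

Section RightSeparated.
Variables (T : Type) (R : set T) (le : T -> T -> Prop).
Variables (x : T -> X) (U : T -> set X).
Hypothesis R_reg : regular_card R.
Hypothesis le_min : forall B, B `<=` R -> B !=set0 ->
  exists2 m, B m & forall b, B b -> le m b.
Hypothesis le_anti : forall a b, R a -> R b -> le a b -> le b a -> a = b.
(* With [R] of regular cardinality kappa, the next hypothesis makes [le] a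
   well-order of type kappa. *)
Hypothesis le_small : forall a, R a -> ~ (R #<= [set b | R b /\ le b a]).
Hypothesis U_nbhs : forall a, R a -> open_nbhs (x a) (U a).
Hypothesis U_right : forall a b, R a -> R b -> ~ le b a -> ~ U a (x b).

(** The points that are not limits of earlier ones form a discrete subspace,
being separated from later points by [U] and from earlier ones by a closure; so
there are few of them.  They are dense, because the least point outside their
closure would be a limit of earlier points and those lie in the closure. *)
Lemma exists_small_dense A :
  (forall B, B `<=` R -> R #<= B -> ~ discrete_family x B) ->
  A `<=` R -> exists L, [/\ L `<=` A, ~ (R #<= L) &
    forall a, A a -> closure (x @` L) (x a)].
Proof.
move=> nodiscr AR.
pose L := [set a | A a /\ ~ closure (x @` [set b | A b /\ ~ le a b]) (x a)].
exists L; split=> [a []//|RL|].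
  apply: (nodiscr L) => //; first by move=> a [/AR].
  exists (fun a => U a `&` ~` closure (x @` [set b | A b /\ ~ le a b])).
  move=> a [Aa na]; have [Uo Ua] := U_nbhs (AR _ Aa); split.
    split=> //; apply: openI => //.
    by apply: closed_openC; exact: closed_closure.
  move=> b [Ab _] [Ub nb]; apply: le_anti; [exact: AR|exact: AR| |].
    by apply: contrapT => nab; apply: nb; apply: subset_closure; exists b.
  by apply: contrapT => /U_right; apply => //; exact: AR.
apply: contrapT => /existsNP[a0 /not_implyP[Aa0 na0]].
have [||a [Aa na] amin] :=
  @le_min [set a | A a /\ ~ closure (x @` L) (x a)].
- by move=> a [/AR].
- by exists a0.
have nLa : ~ L a by move=> La; apply: na; apply: subset_closure; exists a.
have cla : closure (x @` [set b | A b /\ ~ le a b]) (x a).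
  by apply: contrapT => ncl; apply: nLa.
apply: na; rewrite [closure _](closure_id _).1; last exact: closed_closure.
apply: closureS cla => _ [b [Ab nab] <-].
by apply: contrapT => nb; apply: nab; exact: amin.
Qed.

(** Suppose that no discrete subfamily is full, and call [L] the small dense set
of indices given by [exists_small_dense].  Each twice shrunk neighborhood [O2 a]
contains some [x p] with [p] in [L], and by regularity a full set [A] of indices
has the same [p].  Since [O2 a] and [O2 b] meet for [a < b] in [A], monotone
normality gives that [x a] belongs to [O1 b]: every point of the family [A] has
all its predecessors close to it.  Now apply [exists_small_dense] to [A] and
take [v < u] in [A] above the small dense set [L'] so obtained.  The point [x u]
has a neighborhood disjoint from [O1 v], namely [O] of the complement of [x v]
in [U u]; but [O1 v] contains the dense points. *)
Lemma right_separated_discrete :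
  exists A, [/\ A `<=` R, R #<= A & discrete_family x A].
Proof.
apply: contrapT => nodiscr.
have {}nodiscr B : B `<=` R -> R #<= B -> ~ discrete_family x B.
  by move=> BR RB dB; apply: nodiscr; exists B.
pose O1 a := O (x a) (U a); pose O2 a := O (x a) (O1 a).
have O1P a : R a -> open_nbhs (x a) (O1 a) /\ O1 a `<=` U a.
  by move=> Ra; exact: O_nbhs (U_nbhs Ra).
have O2P a : R a -> open_nbhs (x a) (O2 a) /\ O2 a `<=` O1 a.
  by move=> /O1P[/O_nbhs].
have [L [LR Lsmall Ldense]] := exists_small_dense nodiscr (@subset_refl _ R).
have card_ltR B : B `<=` R -> ~ (R #<= B) -> card_lt B R.
  by move=> BR; split=> //; exact: subset_card_le.
have [p Lp Rp] : exists2 p, L p & R #<= [set a | R a /\ O2 a (x p)].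
  apply: regular_pigeonhole (card_ltR _ LR Lsmall) _ => //.
  apply: subset_card_le => a Ra.
  have [|_ [[p Lp <-] O2p]] := Ldense a Ra (O2 a).
    by apply: open_nbhs_nbhs; have [] := O2P _ Ra.
  by exists p.
set A := [set a | _] in Rp.
have AR : A `<=` R by move=> a [].
have chain a b : A a -> A b -> ~ le b a -> O1 b (x a).
  move=> [Ra pa] [Rb pb] nba.
  have [] // := O_sep (U_nbhs Ra) (O1P _ Rb).1.
    by exists (x p); split=> //; exact: (O2P _ Ra).2.
  by move=> /(U_right Ra Rb nba).
have [L' [L'A L'small L'dense]] := exists_small_dense nodiscr AR.
have L'R : L' `<=` R by move=> a /L'A /AR.
have [v Av vP] : exists2 v, A v & forall l, L' l -> ~ le v l.
  apply: contrapT => nov.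
  have [|||l L'l] := @regular_pigeonhole _ _ _ R L'
      (fun l => [set b | R b /\ le b l]) => //.
  - exact: card_ltR.
  - apply: card_le_trans Rp _; apply: subset_card_le => v Av.
    apply: contrapT => nl; apply: nov; exists v => // l L'l vl; apply: nl.
    by exists l => //; split=> //; exact: AR.
  - by apply: le_small; exact: L'R.
have [u Au uv] : exists2 u, A u & ~ le u v.
  apply: contrapT => nou; apply: (le_small (AR _ Av)).
  apply: card_le_trans Rp _; apply: subset_card_le => u Au.
  by split; [exact: AR | apply: contrapT => nuv; apply: nou; exists u].
have [Ru Rv] := (AR _ Au, AR _ Av).
have W_nbhs : open_nbhs (x u) (U u `&` ~` [set x v]).
  have [Uo Uu] := U_nbhs Ru; split.
    apply: openI => //; apply: closed_openC; exact: accessible_closed_set1.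
  split=> // xuv; apply: (U_right Rv Ru uv); rewrite /= in xuv; rewrite xuv.
  by have [] := U_nbhs Rv.
have [|_ [[l L'l <-] Ol]] := L'dense u Au (O (x u) (U u `&` ~` [set x v])).
  by apply: open_nbhs_nbhs; have [] := O_nbhs W_nbhs.
have [] := O_sep W_nbhs (U_nbhs Rv).
- by exists (x l); split=> //; apply: chain => //; [exact: L'A|exact: vP].
- exact: U_right.
- by move=> [_ /(_ erefl)].
Qed.

End RightSeparated.

(** Shrinking the isolating neighborhoods once makes them pairwise disjoint;
shrinking them once more gives a family [N2] to which weak linear Lindelofness
applies.  If [O y V] meets [N2 a], then [y] lies in [N1 a], which happens for at
most one [a], or [x a] lies in [V]. *)
Lemma discrete_complete_accumulation T (x : T -> X) (A : set T) :
  weakly_linearly_lindelof X -> regular_card A -> ~ countable A ->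
  discrete_family x A ->
  exists y, forall V, open_nbhs y V -> A #<= [set a | A a /\ V (x a)].
Proof.
move=> wll Areg Anc [N NP].
have N_nbhs a : A a -> open_nbhs (x a) (N a) by move=> /NP[].
pose N1 a := O (x a) (N a); pose N2 a := O (x a) (N1 a).
have N1P a : A a -> open_nbhs (x a) (N1 a) by move=> /N_nbhs/O_nbhs[].
have N2P a : A a -> open_nbhs (x a) (N2 a) /\ N2 a `<=` N1 a.
  by move=> /N1P/O_nbhs.
have N1_disj y a b : A a -> A b -> N1 a y -> N1 b y -> a = b.
  move=> Aa Ab ay by_; have [|xaNb|xbNa] := O_sep (N_nbhs _ Aa) (N_nbhs _ Ab).
  - by exists y.
  - by apply/esym; exact: (NP _ Ab).2.
  - exact: (NP _ Aa).2.
have FA : N2 @` A #= A.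
  apply: inj_card_eq => a b /set_mem Aa /set_mem Ab eN2.
  have [[_ xa] sub] := N2P _ Aa.
  apply: (N1_disj (x a)) => //; first exact: sub.
  by apply: (N2P _ Ab).2; rewrite -eN2.
have [||| y yP] := wll (N2 @` A).
- by move=> _ [a Aa <-]; have [[No Na] _] := N2P _ Aa; split=> //; exists (x a).
- by rewrite (eq_countable FA).
- by apply: regular_card_eq Areg; rewrite card_eq_sym.
exists y => V V_nbhs.
have [OV_nbhs _] := O_nbhs V_nbhs.
have Ainf : infinite_set A by case: Areg.
have [||//] := @regular_card_le_setU _ _ A [set a | A a /\ N1 a y]
    [set a | A a /\ V (x a)] Areg.
  rewrite -(card_le_eql FA); have /card_eqPle[_ Fle] := yP _ OV_nbhs.
  apply: card_le_trans Fle _; apply: card_le_trans (_ : _ #<=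
      [set a | A a /\ O y V `&` N2 a !=set0]) _.
    apply: card_le_trans (card_image_le N2 _); apply: subset_card_le.
    by move=> _ [[a Aa <-] Va]; exists a.
  apply: subset_card_le => a [Aa Va].
  by have [N1y|Vx] := O_sep V_nbhs (N1P _ Aa) Va; [left|right].
move=> /card_le_finite finA; exfalso; apply: Ainf; apply: finA.
have [[a [Aa ya]]|no] := pselect ([set a | A a /\ N1 a y] !=set0).
  by apply: sub_finite_set (finite_set1 a) => b [Ab yb]; exact: N1_disj yb ya.
by apply: sub_finite_set (@finite_set0 T) => b ?; case: no; exists b.
Qed.

(** * Countable increasing covers of monotonically normal spaces *)

Definition shrink r x V := iter r (O x) V.

Lemma shrink_nbhs r x V : open_nbhs x V -> open_nbhs x (shrink r x V).
Proof. by move=> Vx; elim: r => //= r /O_nbhs[]. Qed.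

Lemma shrink_sub m n x V : open_nbhs x V -> (m <= n)%N ->
  shrink n x V `<=` shrink m x V.
Proof.
move=> Vx /subnK <-; elim: (n - m)%N => //= r IHr.
by apply: subset_trans IHr; have [] := O_nbhs (shrink_nbhs (r + m) Vx).
Qed.

Lemma shrink_mono r x U V : U `<=` V -> shrink r x U `<=` shrink r x V.
Proof. by move=> UV; elim: r => //= r IHr; exact: O_mono. Qed.

(* The cover is given by its level function: [W n] is the set of points of level
   at most [n]. *)
Section CountableCover.
Variable lev : X -> nat.
Hypothesis lev_open : forall n, open [set y | (lev y <= n)%N].

Definition lev_ball r x := shrink r x [set y | (lev y <= lev x)%N].

Lemma lev_ball0_nbhs x : open_nbhs x [set y | (lev y <= lev x)%N].
Proof. by split; [exact: lev_open | rewrite /=]. Qed.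

Lemma lev_ball_nbhs r x : open_nbhs x (lev_ball r x).
Proof. exact: shrink_nbhs (lev_ball0_nbhs x). Qed.

Lemma lev_ball_sub m n x : (m <= n)%N -> lev_ball n x `<=` lev_ball m x.
Proof. exact: shrink_sub (lev_ball0_nbhs x). Qed.

(** Of two meeting shrunk neighborhoods, the one centered at the higher level
catches the other center: the neighborhood at the lower level contains no
point of higher level. *)
Lemma lower_center_mem x y V : (lev x < lev y)%N -> open_nbhs y V ->
  lev_ball 1 x `&` O y V !=set0 -> V x.
Proof.
move=> xy Vy meet; have [//|/=] := O_sep (lev_ball0_nbhs x) Vy meet.
by rewrite leqNgt xy.
Qed.

(** A tower is the only obstruction to the naive expansion: if a point [y] lies
in the shrunk balls of points of arbitrarily high levels, some of these points
form a tower.  The depth 3 makes [tower_catch] end in a ball of depth 2, the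
depth of the hulls; for hulls that meet, monotone normality still puts one
center in the ball of depth 1 around the other. *)
Definition tower (s : nat -> X) := forall i j, (i < j)%N ->
  (lev (s i) < lev (s j))%N /\ lev_ball 3 (s j) (s i).

Lemma tower_lev s i : tower s -> (i <= lev (s i))%N.
Proof.
move=> ts; elim: i => // i IHi; apply: leq_ltn_trans IHi _.
by have [] := ts i i.+1.
Qed.

Definition tower_hull (s : nat -> X) := \bigcup_i lev_ball 2 (s i).

(** A tower that enters a neighborhood of [z] swallows [z]: some later element
has level above that of [z], and its ball meets the ball of [z]. *)
Lemma tower_catch s i z : tower s -> lev_ball 1 z (s i) ->
  exists l, lev_ball 2 (s l) z.
Proof.
move=> ts zi; pose l := maxn i.+1 (lev z).+1; exists l.
have [|_ il] := ts i l; first exact: leq_maxl.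
have zl : (lev z < lev (s l))%N.
  by apply: leq_trans (tower_lev _ ts); exact: leq_maxr.
by apply: lower_center_mem zl (lev_ball_nbhs 2 _) _; exists (s i).
Qed.

(* Neighborhoods are kept away from the points of a maximal family [S] of towers
   with pairwise disjoint hulls.  By maximality a tower of the new neighborhoods
   would interleave with one in [S], and so it cannot exist. *)
Section Towers.
Variable S : set (nat -> X).
Hypothesis S_max : maximal_disjoint_subcollection tower_hull S tower.

Let S_tower s : S s -> tower s.
Proof. by have [ST _ _] := S_max; exact: ST. Qed.

Definition obstacle z :=
  [set d | [/\ (lev d < lev z)%N, lev_ball 1 z d &
                exists2 s, S s & exists i, s i = d]].

(** By [tower_catch], [z] lies in the hull of every tower with an element in the
ball of [z].  The hulls are disjoint, so a single tower is concerned, and it has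
finitely many elements below the level of [z]. *)
Lemma finite_obstacle z : finite_set (obstacle z).
Proof.
have [[d0 [_ zd0 [s Ss [i si]]]]|no] := pselect (obstacle z !=set0); last first.
  by apply: sub_finite_set (@finite_set0 X) => d ?; case: no; exists d.
apply: (@sub_finite_set _ _ (s @` `I_(lev z))); last first.
  exact/finite_image/finite_II.
move=> d [dz zd [s' Ss' [j sj]]].
have -> : s = s'.
  have [_ Striv _] := S_max; apply: Striv => //.
  have [|l sl] := @tower_catch s i z (S_tower Ss); first by rewrite si.
  have [|l' sl'] := @tower_catch s' j z (S_tower Ss'); first by rewrite sj.
  by exists z; split; [exists l | exists l'].
exists j => //=; apply: leq_ltn_trans (tower_lev _ (S_tower Ss')) _.
by rewrite sj.
Qed.

Definition cleared z := lev_ball 1 z `&` ~` obstacle z.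

Lemma cleared_nbhs z : open_nbhs z (cleared z).
Proof.
have [bo bz] := lev_ball_nbhs 1 z; split; last first.
  by split=> // -[]; rewrite ltnn.
apply: openI => //; apply: closed_openC.
move/accessible_finite_set_closed: T1; apply; exact: finite_obstacle.
Qed.

Lemma cleared_avoids s i z : S s -> (lev (s i) < lev z)%N ->
  ~ (lev_ball 1 (s i) `&` O z (cleared z) !=set0).
Proof.
move=> Ss iz /(lower_center_mem iz (cleared_nbhs z)) [zi]; apply.
by split=> //; exists s => //; exists i.
Qed.

Lemma cleared_sub r z : shrink r z (cleared z) `<=` lev_ball r z.
Proof.
apply: shrink_mono => y [/(lev_ball_sub (leq0n 1))]; exact.
Qed.

(** By maximality the hull of [t] meets the hull of a tower [s] in [S], so by
monotone normality some [t i] lies in a ball of [s], possibly after passing to a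
later element of [s].  A high element [t j] then has [t i] in its cleared
neighborhood and also in the ball of an element of [s] of lower level, which
[cleared_avoids] forbids. *)
Lemma no_cleared_tower (t : nat -> X) :
  (forall i j, (i < j)%N -> (lev (t i) < lev (t j))%N) ->
  ~ (forall i j, (i < j)%N -> shrink 3 (t j) (cleared (t j)) (t i)).
Proof.
move=> tlt tt.
have ttower : tower t.
  by move=> i j ij; split; [exact: tlt | apply: cleared_sub; exact: tt].
have t_outside s l i : S s -> ~ lev_ball 1 (s l) (t i).
  move=> Ss li; pose j := maxn i.+1 (lev (s l)).+1.
  apply: (@cleared_avoids s l (t j) Ss).
    by apply: leq_trans (tower_lev _ ttower); exact: leq_maxr.
  exists (t i); split=> //.
  apply: (@shrink_sub 1 3 _ _ (cleared_nbhs _)) => //.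
  by apply: tt; exact: leq_maxl.
have [s Ss [w [[l _ lw] [i _ iw]]]] :
    exists2 s, S s & tower_hull s `&` tower_hull t !=set0.
  have [_ Striv Smax] := S_max.
  apply: contrapT => nomeet.
  have nSt : ~ S t.
    move=> St; apply: nomeet; exists t => //; exists (t 0%N).
    by split; exists 0%N => //; have [] := lev_ball_nbhs 2 (t 0%N).
  apply: (Smax (S `|` [set t])).
  - by split=> [u|sub]; [left | apply: nSt (sub t (or_intror erefl))].
  - by move=> u [/S_tower//|->].
  - move=> u v [Su|->] [Sv|->] // meet; first exact: Striv.
      by case: nomeet; exists u.
    by case: nomeet; exists v => //; rewrite setIC.
have [|sb|tb] := O_sep (lev_ball_nbhs 1 (s l)) (lev_ball_nbhs 1 (t i)).
- by exists w.
- have [l' tl'] := tower_catch (S_tower Ss) sb.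
  by apply: (t_outside s l' i Ss); exact: lev_ball_sub tl'.
- exact: t_outside tb.
Qed.

(** The centers of these neighborhoods of [y], thinned out to have increasing
levels, form a tower of cleared neighborhoods by [lower_center_mem]. *)
Lemma bigcap_cleared_empty y :
  ~ (forall n, exists2 z, (n <= lev z)%N & shrink 4 z (cleared z) y).
Proof.
move=> yP.
have [n|z zP] := @choice nat X
    (fun n z => (n <= lev z)%N /\ shrink 4 z (cleared z) y).
  by have [z nz zy] := yP n; exists z.
(* Each step jumps above the level of the previous center. *)
pose m i := iter i (fun k => (lev (z k)).+1) 0%N; pose t i := z (m i).
have ty i : shrink 4 (t i) (cleared (t i)) y by have [] := zP (m i).
have tlt i j : (i < j)%N -> (lev (t i) < lev (t j))%N.
  move: i j; apply: (@homo_ltn _ (lev \o t) (fun m n => m < n)%N) => [? ? ?|i].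
    exact: ltn_trans.
  by have [] := zP (m i.+1).
apply: (no_cleared_tower tlt) => i j ij.
apply: lower_center_mem (tlt _ _ ij) (shrink_nbhs 3 (cleared_nbhs _)) _.
exists y; split; last exact: ty.
by apply: (@lev_ball_sub 1 4) => //; exact: cleared_sub.
Qed.

End Towers.

(** The points of level more than [n] are covered by the open set [H n], and the
sets [H n] have empty intersection, so their complements are as required. *)
Lemma closed_exhaustion : exists K : nat -> set X,
  [/\ forall n, closed (K n), forall n, K n `<=` [set y | (lev y <= n)%N] &
      \bigcup_n K n = [set: X]].
Proof.
have [S S_max] := ex_maximal_disjoint_subcollection tower_hull tower.
pose H n := \bigcup_(z in [set z | (n < lev z)%N]) shrink 4 z (cleared S z).
exists (fun n => ~` H n).
split=> [n|n y nHy|].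
- apply: open_closedC; apply: bigcup_open => z _.
  by have [] := shrink_nbhs 4 (cleared_nbhs S_max z).
- rewrite /= leqNgt; apply/negP => ny; apply: nHy; exists y => //.
  by have [] := shrink_nbhs 4 (cleared_nbhs S_max y).
- apply/seteqP; split=> // y _; apply: contrapT => ny.
  apply: (bigcap_cleared_empty S_max (y := y)) => n.
  have /contrapT[z nz zy] : ~ ~ H n y by move=> nHy; apply: ny; exists n.
  by exists z => //; exact: ltnW.
Qed.

End CountableCover.

End MonotoneNormality.

(** Monotonically normal spaces are countably paracompact; this is the
formulation by closed shrinkings of increasing covers. *)
Lemma monotonically_normal_exhaustion (X : topologicalType) (W : nat -> set X) :
  accessible_space X -> monotonically_normal X ->
  (forall n, open (W n)) -> (forall n, W n `<=` W n.+1) ->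
  \bigcup_n W n = [set: X] ->
  exists K : nat -> set X, [/\ forall n, closed (K n),
    forall n, K n `<=` W n & \bigcup_n K n = [set: X]].
Proof.
move=> T1 /monotone_operator[O [Onb Osep Omono]] Wo Winc WX.
have [y|lev levP] := @choice X nat
    (fun y n => W n y /\ forall m, W m y -> (n <= m)%N).
  have : exists n, `[<W n y>].
    have : [set: X] y by [].
    by rewrite -WX => -[n _ Wy]; exists n; exact/asboolP.
  move=> /ex_minnP[n /asboolP Wy nmin]; exists n; split=> // m Wm.
  by apply: nmin; exact/asboolP.
have levE n : [set y | (lev y <= n)%N] = W n.
  apply/seteqP; split=> [y /= yn|y /(levP y).2//].
  apply: (@homo_leq _ W subset) yn y (levP y).1; last exact: Winc.
    exact: subset_refl.
  by move=> ? ? ? ; exact: subset_trans.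
have [n|K [Kc KW KX]] := closed_exhaustion T1 Onb Osep Omono (lev := lev).
  by rewrite levE.
by exists K; split=> // n; rewrite -levE.
Qed.

(** * Minimal covers without countable subcovers *)

(** The regular case.  The index set of the right-separated points is the set
[R] of those members of [C] that are least among the members containing some
point of [K]; [R] covers [K], so it is as large as [C]. *)
Lemma no_regular_minimal_cover (X : topologicalType) (K : set X)
    (C : set (set X)) :
  accessible_space X -> monotonically_normal X -> weakly_linearly_lindelof X ->
  closed K -> (forall U, C U -> open U) -> K `<=` \bigcup_(U in C) U ->
  (forall D, D `<=` C -> K `<=` \bigcup_(U in D) U -> C #<= D) ->
  regular_card C -> ~ countable C -> False.
Proof.
move=> T1 [O [Onb Osep]] wll Kc Co KC Cmin Creg Cnc.
have [le [le_min le_anti le_small]] := exists_initial_order C.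
pose least U y := [/\ K y, U y & forall V, C V -> V y -> le U V].
pose R := [set U | C U /\ exists y, least U y].
have RC : R `<=` C by move=> U [].
have KR : K `<=` \bigcup_(U in R) U.
  move=> y Ky; have [||U [CU Uy] Umin] := le_min [set U | C U /\ U y].
  - by move=> U [].
  - by have [U CU Uy] := KC _ Ky; exists U.
  - exists U => //; split=> //; exists y; split=> // V CV Vy.
    exact: Umin.
have CR := Cmin R RC KR.
have eqCR : C #= R by apply/card_eqPle; split=> //; exact: subset_card_le.
have Rreg := regular_card_eq eqCR Creg.
have Rinf : infinite_set R by case: Rreg.
have [U0 [_ [y0 _]]] := infinite_setN0 Rinf.
have [U|x xP] := @choice (set X) X (fun U y => R U -> least U y).
  have [[CU [y ly]]|nRU] := pselect (R U); first by exists y.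
  by exists y0.
(* An initial segment closed at [U] is an open one together with [U]. *)
have small U : R U -> ~ (R #<= [set V | R V /\ le V U]).
  move=> RU leU; have CU := RC _ RU.
  have [||] := @regular_card_le_setU _ _ R [set V | C V /\ ~ le U V]
      [set U] Rreg.
  - apply: card_le_trans leU _; apply: subset_card_le => V [RV VU].
    have [UV|nUV] := pselect (le U V); [right|left].
      by apply: le_anti => //; exact: RC.
    by split=> //; exact: RC.
  - by move=> /(card_le_trans CR); exact: le_small.
  - by move=> /card_le_finite /(_ (finite_set1 U)).
have [||||A [AR RA Adiscr]] :=
    @right_separated_discrete X O T1 Onb Osep _ R le x id Rreg _ _ small.
- move=> B BR; apply: le_min; exact: subset_trans BR RC.
- by move=> U V /RC CU /RC CV; exact: le_anti.
- by move=> U RU; have [CU _] := RU; split; [exact: Co | have [] := xP _ RU].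
- move=> U V RU RV nVU UxV; apply: nVU.
  by have [_ _] := xP _ RV; apply => //; exact: RC.
have eqRA : R #= A by apply/card_eqPle; split=> //; exact: subset_card_le.
have [||y yP] := discrete_complete_accumulation Onb Osep wll _ _ Adiscr.
- exact: regular_card_eq eqRA Rreg.
- by rewrite -(eq_countable eqRA) -(eq_countable eqCR).
(* Outside [K] there is no point of the family; inside, a member of [R] contains
   too few of them. *)
have [Ky|nKy] := pselect (K y).
  have [U RU Uy] := KR _ Ky; apply: (small _ RU).
  apply: card_le_trans RA _.
  apply: card_le_trans (_ : A #<= [set V | A V /\ U (x V)]) _.
    by apply: yP; split=> //; apply: Co; exact: RC.
  apply: subset_card_le => V [/AR RV UxV]; split=> //.
  by have [_ _] := xP _ RV; apply => //; exact: RC.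
apply: Rinf; apply: card_le_finite (finite_set0 X); apply: card_le_trans RA _.
apply: card_le_trans (_ : A #<= [set V | A V /\ (~` K) (x V)]) _.
  by apply: yP; split=> //; exact: closed_openC.
rewrite (_ : [set V | _] = set0) ?card_ge0//.
by apply/seteqP; split=> // V [/AR /xP[]].
Qed.

Definition countably_covered (X : topologicalType) (C : set (set X))
    (K : set X) :=
  exists D, [/\ D `<=` C, countable D & K `<=` \bigcup_(U in D) U].

(** Working with closed subsets avoids computing the size of a finite union of
small families: first cover what lies outside the union of [B n], using the
induction hypothesis; what remains uncovered is closed and inside that union. *)
Lemma countably_covered_finite_union (X : topologicalType) (C : set (set X))
    (B : nat -> set (set X)) n (L : set X) :
  (forall U, C U -> open U) -> (forall i, B i `<=` C) ->
  (forall i L, closed L -> L `<=` \bigcup_(U in B i) U ->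
     countably_covered (B i) L) ->
  closed L -> L `<=` \bigcup_(i in `I_n) \bigcup_(U in B i) U ->
  countably_covered C L.
Proof.
move=> Co BC Bcov; elim: n L => [|n IHn] L Lc LB.
  by exists set0; split=> // y /LB[].
have Bo : open (\bigcup_(U in B n) U) by apply: bigcup_open => U /BC/Co.
have [||D1 [D1C D1c LD1]] := IHn (L `\` \bigcup_(U in B n) U).
- by apply: closedI => //; exact: open_closedC.
- move=> y [/LB[i /= + Vy] nVy]; rewrite ltnS leq_eqVlt => /orP[/eqP ein|lt_in].
    by case: nVy; rewrite -ein.
  by exists i.
have [||D2 [D2B D2c LD2]] := Bcov n (L `\` \bigcup_(U in D1) U).
- apply: closedI => //; apply: open_closedC; apply: bigcup_open => U /D1C.
  exact: Co.
- by move=> y [Ly nD1y]; apply: contrapT => nVy; apply: nD1y; exact: LD1.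
exists (D1 `|` D2); split.
- by move=> U [/D1C|/D2B/BC].
- by rewrite -bigcup2E; apply: bigcup_countable => // -[|[|i]] _.
- move=> y Ly; have [[U DU Uy]|nD1y] := pselect ((\bigcup_(U in D1) U) y).
    by exists U => //; left.
  by have [U DU Uy] := LD2 y (conj Ly nD1y); exists U => //; right.
Qed.

Theorem theorem3p17 (X : topologicalType) (hT1 : accessible_space X)
  (hmn : monotonically_normal X) (hwll : weakly_linearly_lindelof X) :
  lindelof X.
Proof.
pose bad (C : set (set X)) := (forall U, C U -> open U) /\
  exists K, [/\ closed K, K `<=` \bigcup_(U in C) U & ~ countably_covered C K].
move=> C0 C0o C0X; apply: contrapT => C0bad.
have [|C [Co [K [Kc KC Kbad]]] Cmin] := @exists_minimal_card _ bad.
  exists C0; split=> //; exists setT; split=> //; first by rewrite C0X.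
  move=> [D [DC Dc DX]]; apply: C0bad; exists D; split=> //.
  by apply/seteqP; split.
(* Minimality: a smaller open family that covers a closed set has a countable
   subcover. *)
have good (B : set (set X)) (L : set X) :
    (forall U, B U -> open U) -> closed L ->
    L `<=` \bigcup_(U in B) U -> ~ (C #<= B) -> countably_covered B L.
  move=> Bo Lc LB nCB; apply: contrapT => Lbad; apply: nCB; apply: Cmin.
  by split=> //; exists L.
have Cnc : ~ countable C.
  by move=> Cc; apply: Kbad; exists C; split=> //; exact: KC.
have [Creg|Csing] := pselect (regular_card C).
  apply: (no_regular_minimal_cover hT1 hmn hwll Kc Co KC _ Creg Cnc) => D DC KD.
  apply: contrapT => nCD; have [|E [ED Ec KE]] := good D K _ Kc KD nCD.
    by move=> U /DC/Co.
  by apply: Kbad; exists E; split=> //; exact: subset_trans ED DC.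
have [Q [[QC nCQ] Qsmall QE]] : exists Q : set (set (set X)),
    [/\ card_lt Q C, forall B, Q B -> card_lt B C & \bigcup_(B in Q) B = C].
  apply: contrapT => noQ; apply: Csing; split.
    by move=> /finite_set_countable.
  by move=> Q QC Qsmall QE; apply: noQ; exists Q.
have BC B : Q B -> B `<=` C by move=> QB U BU; rewrite -QE; exists B.
pose V (B : set (set X)) := \bigcup_(U in B) U.
have [|||E [EQ Ec KE]] := good (V @` Q) K _ Kc.
- by move=> _ [B QB <-]; apply: bigcup_open => U /(BC B QB)/Co.
- move=> y /KC[U]; rewrite -QE => -[B QB BU] Uy.
  by exists (V B); [exists B | exists U].
- by move=> CVQ; apply: nCQ; exact: card_le_trans CVQ (card_image_le _ _).
have [E0 EE0] : E !=set0.
  apply: contrapT => nE; apply: Kbad; exists set0; split=> // y /KE[U EU _].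
  by case: nE; exists U.
have [B0 QB0 _] := EQ _ EE0.
have [f [_ fI]] := card_le_injection (ex_intro _ E0 EE0) Ec.
have [n|B BP] := @choice nat _
    (fun n B => Q B /\ forall W, E W -> f W = n -> W = V B).
  have [[W [EW fW]]|noW] := pselect (exists W, E W /\ f W = n).
    have [B QB VB] := EQ _ EW; exists B; split=> // W' EW' fW'.
    by rewrite VB; apply: fI => //; rewrite fW.
  by exists B0; split=> // W EW fW; case: noW; exists W.
(* Adding the complement of [K] turns the cover of [K] into one of [X]. *)
pose W n := ~` K `|` \bigcup_(i in `I_n) V (B i).
have Vo i : open (V (B i)).
  by have [QB _] := BP i; apply: bigcup_open => U /(BC _ QB)/Co.
have [|||F [Fc FW FX]] := monotonically_normal_exhaustion (W := W) hT1 hmn.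
- move=> n; apply: openU; first exact: closed_openC.
  exact: bigcup_open.
- move=> n y [nKy|[i /= ni Vy]]; [by left | right].
  by exists i => //=; exact: ltnW.
- apply/seteqP; split=> // y _.
  have [Ky|nKy] := pselect (K y); last by exists 0%N => //; left.
  have [W' EW' Wy] := KE _ Ky; exists (f W').+1 => //; right.
  by exists (f W') => //=; have [_ /(_ W' EW' erefl) <-] := BP (f W').
have [n|D DP] := @choice nat _ (fun n D => [/\ D `<=` C, countable D &
    K `&` F n `<=` \bigcup_(U in D) U]).
  apply: (@countably_covered_finite_union _ _ B n) => //.
  - by move=> i U BU; have [/BC + _] := BP i; exact.
  - move=> i L Lc LB; have [QB _] := BP i.
    apply: good => //; first by move=> U /(BC _ QB)/Co.
    by have [] := Qsmall _ QB.
  - exact: closedI.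
  - by move=> y [Ky /FW[//|]].
apply: Kbad; exists (\bigcup_n D n); split.
- by move=> U [n _]; have [DC _ _] := DP n; exact: DC.
- by apply: bigcup_countable => // n _; have [] := DP n.
- move=> y Ky; have [n _ Fy] : (\bigcup_n F n) y by rewrite FX.
  by have [_ _ /(_ y (conj Ky Fy))[U DU Uy]] := DP n; exists U => //; exists n.
Qed.
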